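(* Let $n>1$ be an integer. If a solution of the $(n+1)$-body problem of the type described in the context has nonzero angular momentum, that is $c_1\neq0$, and it also has negative total energy $c_2<0$, then there is no collision. Moreover $$D=2nc_1^2c_2m_2+n^2\Big(m_1m_2+\frac{b_n}{2}m_2^2\Big)^2>0$$ and $$\frac{-nm_1m_2-\frac{nb_n}{2}m_2^2+\sqrt D}{2c_2}<r(t)<\frac{-nm_1m_2-\frac{nb_n}{2}m_2^2-\sqrt D}{2c_2},$$ where $b_n=\sum_{j=1}^{n-1}|e^{2\pi ji/n}-1|^{-1}$.
   Context: The gravitational constant is $1$ and the masses $m_1,m_2$ are positive. The solutions considered are the solutions of the $(n+1)$-body problem, with one body $x$ of mass $m_1$ and $n$ bodies $y^1,\dots,y^n$ of mass $m_2$, of the form $$x=(0,0,f),\qquad y^j=\Big(r\cos\big(\theta+\tfrac{2(j-1)\pi}{n}\big),\ r\sin\big(\theta+\tfrac{2(j-1)\pi}{n}\big),\ -\tfrac{m_1}{nm_2}f\Big),\quad j=1,\dots,n,$$ where $$\ddot f=-\frac{(m_1+nm_2)f}{h^3},\qquad \ddot r=\frac{c_1^2}{r^3}-a_n\frac{m_2}{r^2}-\frac{m_1r}{h^3},\qquad r^2\dot\theta=c_1,$$ with $h=\sqrt{r^2+\big(\frac{m_1+nm_2}{nm_2}\big)^2f^2}$, $a_n=\sum_{j=1}^{n-1}\frac{1-e^{2\pi ji/n}}{|e^{2\pi ji/n}-1|^3}$, and $c_1=y_1(0)\dot y_2(0)-y_2(0)\dot y_1(0)$, where $(y_1,y_2)$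 are the first two coordinates of $y^1$ (the angular momentum constant); $r$ is the positive distance of each $y^j$ from the third coordinate axis. The number $c_2$ is the conserved total energy (kinetic plus potential): $$c_2=\tfrac12\Big(m_1|\dot x|^2+m_2\sum_{j}|\dot y^j|^2\Big)-\sum_j\frac{m_1m_2}{|x-y^j|}-\sum_{i<j}\frac{m_2^2}{|y^i-y^j|}.$$
   Formalization: D>0 and the strict bounds on r(t) are asserted only when f is not identically zero; for f identically 0 circular motions have D=0 and elliptic ones attain the bounds. The absence of collisions is asserted for all solutions. *)

(* Defs.v *)
From Stdlib Require Import Reals Lra Lia.
From Coquelicot Require Import Coquelicot.
Open Scope R_scope.

Notation R3 := (R * R * R)%type.

(* Coquelicot's norm on a product is the l2 norm, so [norm] on [R3] is the
   Euclidean one. *)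
Lemma norm_R3 (a b c : R) :
  norm ((a, b, c) : R3) = sqrt (a ^ 2 + b ^ 2 + c ^ 2).
Proof.
  change (sqrt (sqrt (Rabs a ^ 2 + Rabs b ^ 2) ^ 2 + Rabs c ^ 2)
          = sqrt (a ^ 2 + b ^ 2 + c ^ 2)).
  rewrite pow2_sqrt, !pow2_abs; [reflexivity | rewrite !pow2_abs; nra].
Qed.

Definition dist3 (p q : R3) : R := norm (minus p q).

Definition velocity (q : R -> R3) (t : R) : R3 :=
  (Derive (fun s => fst (fst (q s))) t,
   Derive (fun s => snd (fst (q s))) t,
   Derive (fun s => snd (q s)) t).

(* e^{i phi} *)
Definition cis (phi : R) : C := (cos phi, sin phi).

Definition unity_root (n j : nat) : C := cis (2 * PI * INR j / INR n).

Definition a_sum (n : nat) : C :=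
  sum_n_m (fun j => ((1 - unity_root n j)
                     / RtoC (Cmod (unity_root n j - 1) ^ 3))%C) 1 (n - 1).

(* The complex sum is real; see [a_sum_real] below. *)
Definition a_ (n : nat) : R := Re (a_sum n).

Definition b_ (n : nat) : R :=
  sum_n_m (fun j => / Cmod (unity_root n j - 1)%C) 1 (n - 1).

Lemma sum_n_m_rev (g : nat -> R) (N : nat) :
  sum_n_m g 0 N = sum_n_m (fun j => g (N - j)%nat) 0 N.
Proof.
  revert g; induction N as [|N IH]; intros g.
  - now rewrite !sum_n_n.
  - rewrite sum_n_Sm by lia. rewrite (sum_Sn_m _ 0 (S N)) by lia.
    rewrite <- sum_n_m_S, IH, plus_comm, Nat.sub_0_r. reflexivity.
Qed.

Lemma Im_sum_n_m (u : nat -> C) (n m : nat) :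
  Im (sum_n_m u n m) = sum_n_m (fun k => Im (u k)) n m.
Proof.
  destruct (Nat.le_gt_cases n m) as [H|H].
  - induction H as [|m H IH].
    + now rewrite !sum_n_n.
    + rewrite !sum_n_Sm by lia. rewrite <- IH. reflexivity.
  - now rewrite !sum_n_m_zero.
Qed.

Lemma a_sum_real (n : nat) : (1 < n)%nat -> a_sum n = RtoC (a_ n).
Proof.
  intros Hn.
  enough (HIm : Im (a_sum n) = 0).
  { unfold a_. destruct (a_sum n) as [x y]. simpl in *. now rewrite HIm. }
  unfold a_sum. rewrite Im_sum_n_m.
  set (g := fun k => Im _).
  destruct n as [|[|N]]; try lia.
  replace (S (S N) - 1)%nat with (S N) by lia.
  rewrite <- sum_n_m_S.
  assert (Hg : forall k, (k <= N)%nat -> g (S (N - k)) = - g (S k)).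
  { intros k Hk. unfold g.
    assert (HE : unity_root (S (S N)) (S (N - k))
                 = Cconj (unity_root (S (S N)) (S k))).
    { unfold unity_root, cis, Cconj. cbn [fst snd].
      assert (HN : INR (S (S N)) <> 0) by (apply not_0_INR; lia).
      replace (2 * PI * INR (S (N - k)) / INR (S (S N)))
        with (- (2 * PI * INR (S k) / INR (S (S N))) + 2 * INR 1 * PI).
      - now rewrite cos_period, sin_period, cos_neg, sin_neg.
      - replace (S (N - k)) with (S (S N) - S k)%nat by lia.
        rewrite minus_INR by lia. simpl (INR 1). field. exact HN. }
    rewrite HE.
    assert (HM : Cmod (Cconj (unity_root (S (S N)) (S k)) - 1)
                 = Cmod (unity_root (S (S N)) (S k) - 1)).
    { unfold Cmod, Cconj. f_equal. simpl. ring. }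
    rewrite HM. unfold Cdiv.
    generalize (Cmod (unity_root (S (S N)) (S k) - 1) ^ 3).
    intros c. destruct (unity_root (S (S N)) (S k)) as [x y].
    unfold Cconj, Cinv, RtoC, Im. simpl. unfold Rdiv. ring. }
  set (s := sum_n_m _ 0 N).
  enough (s = - s) by lra.
  transitivity (sum_n_m (fun k => g (S (N - k))) 0 N).
  { exact (sum_n_m_rev (fun k => g (S k)) N). }
  rewrite (sum_n_m_ext_loc _ (fun k => mult (K := R_Ring) (-1) (g (S k)))).
  - rewrite (sum_n_m_mult_l (K:=R_Ring)). fold s.
    change (-1 * s = - s). ring.
  - intros k Hk. rewrite Hg by lia. change (- g (S k) = -1 * g (S k)). ring.
Qed.

Section Motion.

Variables (n : nat) (m1 m2 : R) (f r theta : R -> R).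

(* Body 0 is x; bodies 1, ..., n are y^1, ..., y^n. *)
Definition mass (j : nat) : R := match j with O => m1 | S _ => m2 end.

Definition position (j : nat) (t : R) : R3 :=
  match j with
  | O => (0, 0, f t)
  | S _ =>
      (r t * cos (theta t + 2 * INR (j - 1) * PI / INR n),
       r t * sin (theta t + 2 * INR (j - 1) * PI / INR n),
       - (m1 / (INR n * m2)) * f t)
  end.

Definition newton_acceleration (j : nat) (t : R) : R3 :=
  sum_n_m
    (fun k => if Nat.eqb k j then zero
              else scal (mass k / dist3 (position k t) (position j t) ^ 3)
                        (minus (position k t) (position j t)))
    0 n.

Definition kinetic_energy (t : R) : R :=
  / 2 * (m1 * norm (velocity (position 0) t) ^ 2
         + m2 * sum_n_m (fun j => norm (velocity (position j) t) ^ 2) 1 n).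

Definition potential_energy (t : R) : R :=
  - sum_n_m (fun j => m1 * m2 / dist3 (position 0 t) (position j t)) 1 n
  - sum_n_m (fun i =>
      sum_n_m (fun j => m2 ^ 2 / dist3 (position i t) (position j t)) (S i) n)
      1 n.

Definition energy (t : R) : R := kinetic_energy t + potential_energy t.

Definition angular_momentum : R :=
  let y1 := fun t => fst (fst (position 1 t)) in
  let y2 := fun t => snd (fst (position 1 t)) in
  y1 0 * Derive y2 0 - y2 0 * Derive y1 0.

Definition h_ (t : R) : R :=
  sqrt (r t ^ 2 + ((m1 + INR n * m2) / (INR n * m2)) ^ 2 * f t ^ 2).

Definition in_interval (ta tb : Rbar) (t : R) : Prop :=
  Rbar_lt ta t /\ Rbar_lt t tb.

(* A solution of the (n+1)-body problem on the open interval (ta, tb) around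
   the initial time 0, of the prescribed shape.  The interval need not be
   maximal. *)
Record is_solution (ta tb : Rbar) : Prop := {
  sol_initial_time : in_interval ta tb 0;
  sol_r_pos : forall t, in_interval ta tb t -> 0 < r t;
  sol_newton : forall j t, (j <= n)%nat -> in_interval ta tb t ->
    is_derive (position j) t (velocity (position j) t) /\
    is_derive (velocity (position j)) t (newton_acceleration j t);
  sol_f : forall t, in_interval ta tb t ->
    ex_derive f t /\
    is_derive (Derive f) t (- ((m1 + INR n * m2) * f t) / h_ t ^ 3);
  sol_r : forall t, in_interval ta tb t ->
    ex_derive r t /\
    is_derive (Derive r) t
      (angular_momentum ^ 2 / r t ^ 3 - a_ n * (m2 / r t ^ 2)
       - m1 * r t / h_ t ^ 3);
  sol_theta : forall t, in_interval ta tb t ->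
    ex_derive theta t /\ r t ^ 2 * Derive theta t = angular_momentum
}.

(* Bodies i and k collide at the finite time T, which may be an endpoint of
   (ta, tb), if they come arbitrarily close to each other as t -> T.  Interior
   coincidences are already excluded by [sol_r_pos], so the endpoints are what
   matters. *)
Definition collision_at (ta tb : Rbar) (i k : nat) (T : R) : Prop :=
  Rbar_le ta T /\ Rbar_le T tb /\
  forall eps, 0 < eps ->
    exists t, in_interval ta tb t /\ Rabs (t - T) < eps /\
              dist3 (position i t) (position k t) < eps.

Definition has_collision (ta tb : Rbar) : Prop :=
  exists i k T, (i < k <= n)%nat /\ collision_at ta tb i k T.

(* Excludes f = 0 identically: there the motion is Keplerian, r attains the
   extreme values allowed by the energy (circular motions have D = 0), and the
   strict inequalities of the theorem fail. *)
Definition nonplanar (ta tb : Rbar) : Prop :=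
  exists t, in_interval ta tb t /\ f t <> 0.

End Motion.

(* Main.v *)
(** Since [a_n = b_n / 2], the total energy
    [c2 = k f'^2 + n m2 (r'^2 + c1^2 / r^2) / 2 - n m1 m2 / h - n b_n m2^2 / (2 r)],
    with [k > 0], is conserved by the equations for [f] and [r].  As [h >= r], it
    gives [c2 r^2 + A r - n m2 c1^2 / 2 >= 0] with
    [A = n m1 m2 + n b_n m2^2 / 2].  For [c1 <> 0] and [c2 < 0] this bounds [r]
    away from 0, which rules out collisions.  Equality forces [f = f' = 0] at that
    time; then [f] vanishes identically by uniqueness for the linear equation
    [f'' = - q f], whose coefficient [q = (m1 + n m2) / h^3] is bounded because [r]
    is bounded below.  In the nonplanar case the inequality is thus strict, and
    [r] lies strictly between the roots of the quadratic, whose discriminant is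
    [D]. *)

Require Import Defs.
From Stdlib Require Import Reals Lra Lia.
From Coquelicot Require Import Coquelicot.
Open Scope R_scope.

(** * Chords of the regular polygon and the constants [a_] and [b_] *)

Lemma Cmod_unity_root_sub1_sqr (n j : nat) :
  Cmod (unity_root n j - 1) ^ 2 = 2 - 2 * cos (2 * PI * INR j / INR n).
Proof.
  unfold Cmod, unity_root, cis; simpl fst; simpl snd.
  set (u := 2 * PI * INR j / INR n).
  rewrite pow2_sqrt by (apply Rplus_le_le_0_compat; apply pow2_ge_0).
  simpl. generalize (sin2_cos2 u); unfold Rsqr; nra.
Qed.

(** Half-angle formula: the squared modulus is 4 sin^2 (pi d / n), with pi d / n strictly between 0
    and pi. *)
Lemma unity_root_sub1_pos (n d : nat) :
  (0 < d < n)%nat -> 0 < Cmod (unity_root n d - 1).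
Proof.
  intros [Hd Hdn].
  assert (Hd' : 0 < INR d) by (apply lt_0_INR; lia).
  assert (Hdn' : INR d < INR n) by (apply lt_INR; lia).
  assert (Hs : 0 < sin (PI * (INR d / INR n))).
  { assert (0 < INR d / INR n < 1).
    { split; [apply Rdiv_lt_0_compat; lra|].
      apply (Rmult_lt_reg_r (INR n)); [lra|]. field_simplify; lra. }
    apply sin_gt_0; generalize PI_RGT_0; nra. }
  assert (Hc : cos (2 * PI * INR d / INR n)
               = 1 - 2 * sin (PI * (INR d / INR n)) * sin (PI * (INR d / INR n))).
  { rewrite <- cos_2a_sin. f_equal. field. lra. }
  assert (H := Cmod_unity_root_sub1_sqr n d).
  rewrite Hc in H. assert (H0 := Cmod_ge_0 (unity_root n d - 1)).
  destruct H0 as [H0|H0]; [exact H0|]. rewrite <- H0 in H. nra.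
Qed.

(** The two roots are conjugate. This is the symmetry that [sum_pairs] asks of its summand. *)
Lemma Cmod_unity_root_sub1_compl (n k : nat) :
  (0 < n)%nat -> (k <= n)%nat ->
  Cmod (unity_root n (n - k) - 1) = Cmod (unity_root n k - 1).
Proof.
  intros Hn Hk.
  rewrite <- (sqrt_pow2 (Cmod (unity_root n (n - k) - 1))) by apply Cmod_ge_0.
  rewrite <- (sqrt_pow2 (Cmod (unity_root n k - 1))) by apply Cmod_ge_0.
  rewrite !Cmod_unity_root_sub1_sqr. do 3 f_equal.
  rewrite minus_INR by lia.
  assert (INR n <> 0) by (apply not_0_INR; lia).
  replace (2 * PI * (INR n - INR k) / INR n)
    with (- (2 * PI * INR k / INR n) + 2 * INR 1 * PI)
    by (simpl; field; auto).
  now rewrite cos_period, cos_neg.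
Qed.

(* [Re (1 - e) = |e - 1| ^ 2 / 2] for [e] on the unit circle. *)
Lemma a_eq_half_b (n : nat) : (1 < n)%nat -> a_ n = b_ n / 2.
Proof.
  intros Hn. unfold a_, a_sum, b_.
  assert (HRe : forall (u : nat -> C) p q, (p <= q)%nat ->
            Re (sum_n_m u p q) = sum_n_m (fun k => Re (u k)) p q).
  { intros u p q H. induction H as [|q H IH].
    - now rewrite !sum_n_n.
    - rewrite !sum_n_Sm by lia. rewrite <- IH. reflexivity. }
  rewrite HRe by lia.
  transitivity (/ 2 * sum_n_m (fun j => / Cmod (unity_root n j - 1)%C) 1 (n - 1));
    [|lra].
  change (Rmult (/ 2)) with (mult (K := R_Ring) (/ 2)).
  rewrite <- (sum_n_m_mult_l (K := R_Ring)).
  apply sum_n_m_ext_loc. intros j Hj.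
  assert (Hpos := unity_root_sub1_pos n j ltac:(lia)).
  assert (Hsq := Cmod_unity_root_sub1_sqr n j).
  change (mult (/ 2) (/ Cmod (unity_root n j - 1)))
    with (/ 2 * / Cmod (unity_root n j - 1)).
  revert Hpos Hsq. generalize (Cmod (unity_root n j - 1)). intros c Hc Hsq.
  unfold unity_root, cis, Cdiv, Cinv, Cmult, Cminus, Cplus, Copp, RtoC, Re.
  simpl fst; simpl snd.
  set (v := cos _) in *.
  replace v with (1 - c ^ 2 / 2) by lra.
  match goal with |- ?x = ?y => change (@eq R x y) end.
  field. lra.
Qed.

Lemma b_nonneg (n : nat) : (1 < n)%nat -> 0 <= b_ n.
Proof.
  intros Hn. unfold b_.
  apply Rle_trans with (sum_n_m (fun _ : nat => 0) 1 (n - 1)).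
  { right. symmetry. apply (sum_n_m_const_zero (G := R_AbelianMonoid)). }
  (* [sum_n_m_le] compares at every index, so the summand is set to 0 outside 0 < j < n. *)
  apply Rle_trans with
    (sum_n_m (fun j => if (Nat.ltb 0 j && Nat.ltb j n)%bool
                       then / Cmod (unity_root n j - 1)%C else 0) 1 (n - 1)).
  - apply sum_n_m_le. intros j.
    destruct (Nat.ltb 0 j) eqn:E1, (Nat.ltb j n) eqn:E2; simpl; try lra.
    apply Nat.ltb_lt in E1, E2.
    left; apply Rinv_0_lt_compat, unity_root_sub1_pos; lia.
  - right. apply sum_n_m_ext_loc. intros j Hj.
    now rewrite (proj2 (Nat.ltb_lt 0 j)), (proj2 (Nat.ltb_lt j n)) by lia.
Qed.

(** * Sums over pairs of bodies *)

Lemma sum_n_m_shift (g : nat -> R) (d p q : nat) :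
  sum_n_m g (d + p) (d + q) = sum_n_m (fun k => g (d + k)%nat) p q.
Proof.
  induction d as [|d IH] in g |- *; [reflexivity|].
  simpl. rewrite <- sum_n_m_S. apply IH.
Qed.

(* With [G] the partial sums of [g] and [B] the full sum, [G m = B - G (n - 1 - m)];
   summing over [m] gives twice the double sum. *)
Lemma sum_pairs (g : nat -> R) (n : nat) :
  (forall k, (0 < k < n)%nat -> g (n - k)%nat = g k) -> (1 < n)%nat ->
  sum_n_m (fun i => sum_n_m (fun j => g (j - i)%nat) (S i) n) 1 n
  = INR n / 2 * sum_n_m g 1 (n - 1).
Proof.
  intros Hg Hn. destruct n as [|N]; [lia|].
  set (G := fun m => sum_n_m g 1 m). set (B := sum_n_m g 1 (S N - 1)).
  assert (HG : forall m, (m <= N)%nat -> G m = B - G (N - m)%nat).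
  { intros m Hm. unfold B, G.
    replace (S N - 1)%nat with N by lia.
    (* With n = N + 1, the reflection k -> n - k carries the range 1..N-m onto m+1..N. *)
    assert (E : sum_n_m g 1 (N - m) = sum_n_m g (S m) N).
    { destruct (Nat.eq_dec m N) as [->|Hne].
      - now rewrite !sum_n_m_zero by lia.
      - replace (N - m)%nat with (S (N - m - 1)) by lia.
        rewrite <- sum_n_m_S, sum_n_m_rev.
        replace (sum_n_m g (S m) N)
          with (sum_n_m g (S m + 0) (S m + (N - m - 1))) by (f_equal; lia).
        rewrite sum_n_m_shift.
        apply sum_n_m_ext_loc. intros k Hk.
        rewrite <- Hg by lia. f_equal. lia. }
    rewrite E.
    rewrite (sum_n_m_Chasles g 1 m N) by lia.
    change (@eq R (sum_n_m g 1 m)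
              (sum_n_m g 1 m + sum_n_m g (S m) N - sum_n_m g (S m) N)).
    symmetry. apply Rplus_minus_r. }
  (* In row i the difference j - i runs from 1 to n - i; rows are then renumbered from 0. *)
  transitivity (sum_n_m (fun i => G (N - i)%nat) 0 N).
  { rewrite <- sum_n_m_S. apply sum_n_m_ext_loc. intros i Hi. unfold G.
    replace (S (S i)) with (S i + 1)%nat by lia.
    replace (S N) with (S i + (N - i))%nat at 1 by lia.
    rewrite sum_n_m_shift. apply sum_n_m_ext. intros k. f_equal. lia. }
  rewrite <- (sum_n_m_rev G).
  assert (E : sum_n_m G 0 N + sum_n_m G 0 N = INR (S N) * B).
  { rewrite (sum_n_m_rev G) at 1.
    change Rplus with (plus (G := R_AbelianMonoid)).
    rewrite <- sum_n_m_plus.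
    replace (INR (S N)) with (INR (S N - 0)) by (f_equal; lia).
    rewrite <- sum_n_m_const. apply sum_n_m_ext_loc. intros k Hk.
    change (@eq R (G (N - k)%nat + G k) B). rewrite (HG k) by lia. ring. }
  revert E. generalize (sum_n_m G 0 N : R). intros x E.
  change (@eq R x (INR (S N) / 2 * B)). lra.
Qed.

(** * Distances and speeds in the symmetric configuration *)

(** The ring lies at height -m1 f / (n m2), so its vertical gap to the axis body is f (m1 + n m2) /
    (n m2), whence the factor in [h_]. *)
Lemma dist3_axis_ring (n : nat) (m1 m2 : R) (f r theta : R -> R) (t : R) (j : nat) :
  (0 < n)%nat -> 0 < m2 -> (0 < j)%nat ->
  dist3 (position n m1 m2 f r theta 0 t) (position n m1 m2 f r theta j t)
  = h_ n m1 m2 f r t.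
Proof.
  intros Hn Hm2 Hj. destruct j as [|j]; [lia|].
  assert (0 < INR n) by (apply lt_0_INR; lia).
  unfold dist3, position, h_.
  set (u := theta t + _).
  change (norm ((0 - r t * cos u, 0 - r t * sin u,
                 f t - - (m1 / (INR n * m2)) * f t) : R3)
    = sqrt (r t ^ 2 + ((m1 + INR n * m2) / (INR n * m2)) ^ 2 * f t ^ 2)).
  rewrite norm_R3. f_equal.
  replace (f t - - (m1 / (INR n * m2)) * f t)
    with ((m1 + INR n * m2) / (INR n * m2) * f t) by (field; lra).
  generalize (sin2_cos2 u); unfold Rsqr; intros Hsc.
  replace (r t ^ 2) with (r t ^ 2 * (sin u * sin u + cos u * cos u))
    by (rewrite Hsc; ring).
  ring.
Qed.

(** Both bodies lie at the same height on a circle of radius r, so they span a chord whose angle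
    depends on [j - i] only. *)
Lemma dist3_ring_ring (n : nat) (m1 m2 : R) (f r theta : R -> R) (t : R) (i j : nat) :
  (0 < n)%nat -> 0 <= r t -> (0 < i <= j)%nat ->
  dist3 (position n m1 m2 f r theta i t) (position n m1 m2 f r theta j t)
  = r t * Cmod (unity_root n (j - i) - 1).
Proof.
  intros Hn Hr Hij. destruct i as [|i]; [lia|]. destruct j as [|j]; [lia|].
  assert (0 < INR n) by (apply lt_0_INR; lia).
  unfold dist3, position.
  set (u := theta t + 2 * INR (S i - 1) * PI / INR n).
  set (v := theta t + 2 * INR (S j - 1) * PI / INR n).
  set (w := - (m1 / (INR n * m2)) * f t).
  change (norm ((r t * cos u - r t * cos v, r t * sin u - r t * sin v, w - w) : R3)
    = r t * Cmod (unity_root n (S j - S i) - 1)).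
  rewrite norm_R3.
  rewrite <- (sqrt_pow2 (r t * Cmod _))
    by (apply Rmult_le_pos; [lra|apply Cmod_ge_0]).
  f_equal. rewrite Rpow_mult_distr, Cmod_unity_root_sub1_sqr.
  replace (2 * PI * INR (S j - S i) / INR n) with (v - u).
  2:{ unfold u, v. replace (S j - S i)%nat with ((S j - 1) - (S i - 1))%nat by lia.
      rewrite (minus_INR (S j - 1)) by lia. field. lra. }
  rewrite cos_minus.
  generalize (sin2_cos2 u) (sin2_cos2 v); unfold Rsqr; intros Hu Hv.
  replace (2 - 2 * (cos v * cos u + sin v * sin u))
    with ((sin u * sin u + cos u * cos u) + (sin v * sin v + cos v * cos v)
          - 2 * (cos v * cos u + sin v * sin u)) by (rewrite Hu, Hv; ring).
  ring.
Qed.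

Lemma norm_velocity_axis_sqr (n : nat) (m1 m2 : R) (f r theta : R -> R) (t : R) :
  norm (velocity (position n m1 m2 f r theta 0) t) ^ 2 = Derive f t ^ 2.
Proof.
  unfold velocity, position. simpl fst; simpl snd.
  rewrite !Derive_const, norm_R3, pow2_sqrt by nra.
  change (fun s : R => f s) with f. ring.
Qed.

(** In polar coordinates the constant phase of body j cancels, so all ring bodies have the same
    speed. *)
Lemma norm_velocity_ring_sqr (n : nat) (m1 m2 : R) (f r theta : R -> R) (t : R) (j : nat) :
  (0 < j)%nat -> ex_derive r t -> ex_derive theta t ->
  norm (velocity (position n m1 m2 f r theta j) t) ^ 2
  = Derive r t ^ 2 + (r t * Derive theta t) ^ 2
    + (m1 / (INR n * m2) * Derive f t) ^ 2.
Proof.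
  intros Hj Hr Hth. destruct j as [|j]; [lia|].
  cbv beta iota delta [velocity position fst snd].
  set (p := 2 * INR (S j - 1) * PI / INR n).
  assert (E1 : Derive (fun s => r s * cos (theta s + p)) t
     = Derive r t * cos (theta t + p) - r t * Derive theta t * sin (theta t + p)).
  { apply is_derive_unique. auto_derive; [tauto|].
    change (fun x : R => r x) with r. change (fun x : R => theta x) with theta. ring. }
  assert (E2 : Derive (fun s => r s * sin (theta s + p)) t
     = Derive r t * sin (theta t + p) + r t * Derive theta t * cos (theta t + p)).
  { apply is_derive_unique. auto_derive; [tauto|].
    change (fun x : R => r x) with r. change (fun x : R => theta x) with theta. ring. }
  fold p. subst p. rewrite E1, E2, Derive_scal.
  change (fun s : R => f s) with f.
  rewrite norm_R3, pow2_sqrt by nra.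
  generalize (sin2_cos2 (theta t + 2 * INR (S j - 1) * PI / INR n)).
  set (u := theta t + _). unfold Rsqr; intros Hu.
  replace (Derive r t ^ 2 + (r t * Derive theta t) ^ 2)
    with ((Derive r t ^ 2 + (r t * Derive theta t) ^ 2)
          * (sin u * sin u + cos u * cos u)) by (rewrite Hu; ring).
  ring.
Qed.

Lemma h_pos (n : nat) (m1 m2 : R) (f r : R -> R) (t : R) :
  0 < r t -> 0 < h_ n m1 m2 f r t.
Proof.
  intros Hr. unfold h_. apply sqrt_lt_R0.
  assert (H := pow2_ge_0 ((m1 + INR n * m2) / (INR n * m2) * f t)). nra.
Qed.

Lemma h_ge_r (n : nat) (m1 m2 : R) (f r : R -> R) (t : R) :
  0 < r t -> r t <= h_ n m1 m2 f r t.
Proof.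
  intros Hr. unfold h_. rewrite <- (sqrt_pow2 (r t)) at 1 by lra.
  apply sqrt_le_1_alt.
  assert (H := pow2_ge_0 ((m1 + INR n * m2) / (INR n * m2) * f t)). nra.
Qed.

Lemma h_gt_r (n : nat) (m1 m2 : R) (f r : R -> R) (t : R) :
  (0 < n)%nat -> 0 < m1 -> 0 < m2 -> 0 < r t -> f t <> 0 ->
  r t < h_ n m1 m2 f r t.
Proof.
  intros Hn Hm1 Hm2 Hr Hf. unfold h_.
  assert (0 < INR n) by (apply lt_0_INR; lia).
  assert (0 < INR n * m2) by nra.
  rewrite <- (sqrt_pow2 (r t)) at 1 by lra.
  apply sqrt_lt_1_alt. split; [nra|].
  assert (H1 : (m1 + INR n * m2) / (INR n * m2) <> 0).
  { apply Rgt_not_eq, Rdiv_lt_0_compat; lra. }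
  assert (0 < ((m1 + INR n * m2) / (INR n * m2)) ^ 2) by now apply pow2_gt_0.
  assert (0 < f t ^ 2) by now apply pow2_gt_0.
  nra.
Qed.

(** * The energy in terms of f and r, and its conservation *)

(** The parameter [c1] stands for r^2 theta'. The terms are vertical and radial kinetic energy,
    centrifugal energy, axis-ring potential and ring self-potential. The first coefficient combines
    m1 / 2 with the ring's share (n m2 / 2) (m1 / (n m2))^2. *)
Definition reduced_energy (n : nat) (m1 m2 c1 : R) (f r : R -> R) (t : R) : R :=
  m1 * (m1 + INR n * m2) / (2 * (INR n * m2)) * Derive f t ^ 2
  + INR n * m2 / 2 * Derive r t ^ 2
  + INR n * m2 * c1 ^ 2 / 2 / r t ^ 2
  - INR n * m1 * m2 / h_ n m1 m2 f r t
  - INR n * b_ n * m2 ^ 2 / 2 / r t.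

(** By symmetry each single sum has n equal terms, and the ring potential depends on j - i only, so
    [sum_pairs] evaluates it through [b_]. *)
Lemma energy_reduced (n : nat) (m1 m2 : R) (f r theta : R -> R) (c1 t : R) :
  (1 < n)%nat -> 0 < m2 -> 0 < r t -> ex_derive r t -> ex_derive theta t ->
  r t ^ 2 * Derive theta t = c1 ->
  energy n m1 m2 f r theta t = reduced_energy n m1 m2 c1 f r t.
Proof.
  intros Hn Hm2 Hr Dr Dth Hc.
  assert (HN : 0 < INR n) by (apply lt_0_INR; lia).
  assert (Hh := h_pos n m1 m2 f r t Hr).
  unfold energy, kinetic_energy, potential_energy.
  rewrite norm_velocity_axis_sqr.
  rewrite (sum_n_m_ext_loc (fun j => norm _ ^ 2)
    (fun _ => Derive r t ^ 2 + (r t * Derive theta t) ^ 2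
              + (m1 / (INR n * m2) * Derive f t) ^ 2))
    by (intros j Hj; apply norm_velocity_ring_sqr; [lia|auto|auto]).
  rewrite (sum_n_m_ext_loc (fun j => m1 * m2 / _)
    (fun _ => m1 * m2 / h_ n m1 m2 f r t))
    by (intros j Hj; rewrite dist3_axis_ring; [reflexivity|lia|lra|lia]).
  rewrite (sum_n_m_ext_loc (fun i => sum_n_m _ (S i) n)
    (fun i => sum_n_m (fun j => m2 ^ 2 / r t * / Cmod (unity_root n (j - i) - 1))
                (S i) n)).
  2:{ intros i Hi. apply sum_n_m_ext_loc. intros j Hj.
      rewrite dist3_ring_ring by (lia || lra). unfold Rdiv.
      rewrite Rinv_mult. symmetry. apply Rmult_assoc. }
  rewrite (sum_pairs (fun k => m2 ^ 2 / r t * / Cmod (unity_root n k - 1))).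
  2:{ intros k Hk. now rewrite Cmod_unity_root_sub1_compl by lia. }
  2:{ exact Hn. }
  change (fun k => m2 ^ 2 / r t * / Cmod (unity_root n k - 1))
    with (fun k => mult (K := R_Ring) (m2 ^ 2 / r t) (/ Cmod (unity_root n k - 1))).
  rewrite (sum_n_m_mult_l (K := R_Ring)).
  change (mult ?x ?y) with (x * y).
  change (sum_n_m (fun k => / Cmod (unity_root n k - 1)) 1 (n - 1)) with (b_ n).
  rewrite !sum_n_m_const.
  replace (S n - 1)%nat with n by lia.
  unfold reduced_energy. rewrite <- Hc. field. repeat split; lra.
Qed.

Lemma in_interval_between (ta tb : Rbar) (s u t : R) :
  in_interval ta tb s -> in_interval ta tb u -> Rmin s u <= t <= Rmax s u ->
  in_interval ta tb t.
Proof.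
  unfold in_interval, Rmin, Rmax. intros [H1 H2] [H3 H4].
  destruct ta, tb; simpl in *; destruct (Rle_dec s u); intros [H5 H6];
    split; try tauto; lra.
Qed.

(** Since h h' = r r' + k^2 f f', the derivative of the 1/h term cancels the h^-3 forces;
    [a_eq_half_b] matches the r^-2 terms, and the centrifugal terms cancel. *)
Lemma is_derive_reduced_energy (n : nat) (m1 m2 c1 : R) (f r : R -> R) (t : R) :
  (1 < n)%nat -> 0 < m2 -> 0 < r t ->
  ex_derive f t -> ex_derive r t ->
  is_derive (Derive f) t (- ((m1 + INR n * m2) * f t) / h_ n m1 m2 f r t ^ 3) ->
  is_derive (Derive r) t
    (c1 ^ 2 / r t ^ 3 - a_ n * (m2 / r t ^ 2) - m1 * r t / h_ n m1 m2 f r t ^ 3) ->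
  is_derive (reduced_energy n m1 m2 c1 f r) t 0.
Proof.
  intros Hn Hm2 Hr Df Dr DDf DDr.
  assert (HN : 0 < INR n) by (apply lt_0_INR; lia).
  assert (Hh := h_pos n m1 m2 f r t Hr).
  set (k := (m1 + INR n * m2) / (INR n * m2)).
  assert (Dh : is_derive (h_ n m1 m2 f r) t
    ((r t * Derive r t + k ^ 2 * (f t * Derive f t)) / h_ n m1 m2 f r t)).
  { unfold h_ in Hh |- *. fold k in Hh |- *.
    assert (Hp : 0 < r t ^ 2 + k ^ 2 * f t ^ 2)
      by (assert (H := pow2_ge_0 (k * f t)); nra).
    auto_derive.
    - repeat split; auto.
    - change (fun x : R => r x) with r. change (fun x : R => f x) with f.
      replace (r t * (r t * 1) + k * (k * 1) * (f t * (f t * 1)))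
        with (r t ^ 2 + k ^ 2 * f t ^ 2) by ring.
      field. lra. }
  unfold reduced_energy. rewrite (a_eq_half_b n Hn) in DDr.
  set (h := h_ n m1 m2 f r) in *.
  set (F := Derive f) in *. set (Q := Derive r) in *.
  auto_derive.
  - repeat split; try (eexists; eassumption); auto; nra.
  - change (fun x : R => r x) with r. change (fun x : R => f x) with f.
    change (fun x : R => F x) with F. change (fun x : R => Q x) with Q.
    change (fun x : R => h x) with h.
    rewrite (is_derive_unique F _ _ DDf), (is_derive_unique Q _ _ DDr),
      (is_derive_unique h _ _ Dh).
    fold Q. unfold k. field. repeat split; lra.
Qed.

(** The derivative vanishes on the segment between 0 and t; at time 0 the reduced form is the full
    energy. *)
Lemma energy_const (n : nat) (m1 m2 : R) (f r theta : R -> R) (ta tb : Rbar) (t : R) :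
  (1 < n)%nat -> 0 < m2 -> is_solution n m1 m2 f r theta ta tb ->
  in_interval ta tb t ->
  reduced_energy n m1 m2 (angular_momentum n m1 m2 f r theta) f r t
  = energy n m1 m2 f r theta 0.
Proof.
  intros Hn Hm2 Hs Ht. destruct Hs as [H0 Hr _ Hf HR Hth].
  set (c1 := angular_momentum n m1 m2 f r theta) in *.
  rewrite (energy_reduced n m1 m2 f r theta c1 0);
    [|assumption|assumption|now apply Hr|apply HR; auto|apply Hth; auto|apply Hth; auto].
  assert (HD : forall s, in_interval ta tb s ->
            is_derive (reduced_energy n m1 m2 c1 f r) s 0).
  { intros s Hs. destruct (Hf s Hs), (HR s Hs).
    apply is_derive_reduced_energy; auto. }
  destruct (Rtotal_order t 0) as [Hlt|[->|Hgt]]; [|reflexivity|symmetry].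
  - apply eq_is_derive; [|exact Hlt]. intros s Hs. apply HD.
    apply (in_interval_between ta tb t 0); auto.
    rewrite Rmin_left, Rmax_right; lra.
  - apply eq_is_derive; [|exact Hgt]. intros s Hs. apply HD.
    apply (in_interval_between ta tb 0 t); auto.
    rewrite Rmin_left, Rmax_right; lra.
Qed.

(** * The energy inequality, and uniqueness for its equality case *)

(** The two sides differ by r^2 times the sum of the vertical and radial kinetic energies and n m1
    m2 (1/r - 1/h). A nonzero f makes h > r, and a nonzero f' makes the vertical term positive. *)
Lemma reduced_energy_ge (n : nat) (m1 m2 c1 : R) (f r : R -> R) (t : R) :
  (0 < n)%nat -> 0 < m1 -> 0 < m2 -> 0 < r t ->
  let E := reduced_energy n m1 m2 c1 f r t in
  let A := INR n * m1 * m2 + INR n * b_ n / 2 * m2 ^ 2 in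
  let K := INR n * m2 * c1 ^ 2 / 2 in
  K <= E * r t ^ 2 + A * r t
  /\ (f t <> 0 \/ Derive f t <> 0 -> K < E * r t ^ 2 + A * r t).
Proof.
  intros Hn Hm1 Hm2 Hr E A K.
  assert (HN : 0 < INR n) by (apply lt_0_INR; lia).
  assert (Hh := h_pos n m1 m2 f r t Hr).
  assert (HNm : 0 < INR n * m2) by nra.
  set (p := m1 * (m1 + INR n * m2) / (2 * (INR n * m2)) * Derive f t ^ 2).
  set (w := / r t - / h_ n m1 m2 f r t).
  set (q := INR n * m2 / 2 * Derive r t ^ 2).
  assert (HE : E * r t ^ 2 + A * r t - K
               = (p + q + INR n * m2 * m1 * w) * r t ^ 2).
  { unfold E, reduced_energy, A, K, p, q, w. field. repeat split; lra. }
  assert (Hk : 0 < m1 * (m1 + INR n * m2) / (2 * (INR n * m2)))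
    by (apply Rdiv_lt_0_compat; nra).
  assert (Hp : 0 <= p) by (apply Rmult_le_pos; [lra|apply pow2_ge_0]).
  assert (Hq : 0 <= q) by (apply Rmult_le_pos; [lra|apply pow2_ge_0]).
  assert (Hw : 0 <= w).
  { assert (/ h_ n m1 m2 f r t <= / r t)
      by (apply Rinv_le_contravar; [lra|now apply h_ge_r]).
    unfold w; lra. }
  assert (Hr2 : 0 < r t ^ 2) by nra.
  assert (HNmm : 0 < INR n * m2 * m1) by nra.
  assert (Hw' : 0 <= INR n * m2 * m1 * w) by nra.
  split; [nra|].
  intros Hf.
  enough (0 < p + q + INR n * m2 * m1 * w) by nra.
  destruct Hf as [Hf|Hf].
  - assert (/ h_ n m1 m2 f r t < / r t).
    { apply Rinv_lt_contravar; [nra|now apply h_gt_r]. }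
    assert (0 < w) by (unfold w; lra). nra.
  - assert (0 < p) by (apply Rmult_lt_0_compat; [lra|now apply pow2_gt_0]). lra.
Qed.

(* Gronwall: [w exp (- L s)] and [w exp (L s)] are monotone, in opposite
   directions. *)
Lemma zero_of_derive_bound (w w' : R -> R) (L : R) (P : R -> Prop) (t0 t : R) :
  (forall s u x, P s -> P u -> Rmin s u <= x <= Rmax s u -> P x) ->
  (forall s, P s -> is_derive w s (w' s) /\ 0 <= w s /\ Rabs (w' s) <= L * w s) ->
  P t0 -> P t -> w t0 = 0 -> w t = 0.
Proof.
  intros Hconn Hw H0 Ht Hw0.
  destruct (Hw t Ht) as (_ & Hwt & _).
  assert (Hg : forall c, exists x, P x /\
    w t * exp (c * t) = (w' x + c * w x) * exp (c * x) * (t - t0)).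
  { intros c.
    destruct (MVT_gen (fun s => w s * exp (c * s)) t0 t
                (fun s => (w' s + c * w s) * exp (c * s))) as (x & Hx & E).
    - intros x Hx. assert (Px : P x) by (apply (Hconn t0 t x H0 Ht); lra).
      destruct (Hw x Px) as (D & _).
      auto_derive; [eexists; eassumption|].
      change (fun x : R => w x) with w.
      rewrite (is_derive_unique w _ _ D). ring.
    - intros x Hx. assert (Px : P x) by exact (Hconn t0 t x H0 Ht Hx).
      destruct (Hw x Px) as (D & _).
      apply derivable_continuous_pt. apply ex_derive_Reals_0.
      auto_derive. eexists; eassumption.
    - exists x. split; [exact (Hconn t0 t x H0 Ht Hx)|]. rewrite Hw0 in E. lra. }
  apply Rle_antisym; [|exact Hwt].
  (* The exponent is chosen so that the derivative at x and t - t0 have opposite signs; hence w t <=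
     0. *)
  destruct (Rle_dec t0 t) as [Hle|Hgt];
    [destruct (Hg (- L)) as (x & Px & E) | destruct (Hg L) as (x & Px & E)];
    destruct (Hw x Px) as (_ & _ & B); apply Rabs_le_between in B;
    match type of E with _ * ?a = _ * ?b * _ =>
      assert (0 < a) by apply exp_pos; assert (0 < b) by apply exp_pos;
      set (ea := a) in *; set (eb := b) in * end.
  - assert ((w' x + - L * w x) * eb * (t - t0) <= 0).
    { assert (0 <= - (w' x + - L * w x) * eb) by (apply Rmult_le_pos; lra). nra. }
    nra.
  - assert ((w' x + L * w x) * eb * (t - t0) <= 0).
    { assert (0 <= (w' x + L * w x) * eb) by (apply Rmult_le_pos; lra). nra. }
    nra.
Qed.

(** Gronwall for w = f^2 + f'^2: here w' = 2 f f' (1 - q), with |2 f f'| <= w and |1 - q| <= 1 +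
    M. *)
Lemma linear_oscillator_unique (f q : R -> R) (M : R) (P : R -> Prop) (t0 t : R) :
  (forall s u x, P s -> P u -> Rmin s u <= x <= Rmax s u -> P x) ->
  (forall s, P s -> ex_derive f s /\ is_derive (Derive f) s (- q s * f s)
                    /\ Rabs (q s) <= M) ->
  P t0 -> P t -> f t0 = 0 -> Derive f t0 = 0 -> f t = 0.
Proof.
  intros Hconn Hf H0 Ht Hf0 Hf'0.
  assert (E : f t ^ 2 + Derive f t ^ 2 = 0).
  { apply (zero_of_derive_bound (fun s => f s ^ 2 + Derive f s ^ 2)
             (fun s => 2 * f s * Derive f s * (1 - q s)) (1 + M) P t0 t); auto.
    - intros s Ps. destruct (Hf s Ps) as (D & DD & B). split; [|split].
      + set (F := Derive f) in *.
        auto_derive; [repeat split; auto; eexists; eassumption|].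
        change (fun x : R => f x) with f. change (fun x : R => F x) with F.
        rewrite (is_derive_unique F _ _ DD). fold F. ring.
      + nra.
      + rewrite Rabs_mult, Rmult_comm. apply Rmult_le_compat; try apply Rabs_pos.
        * unfold Rminus. apply Rle_trans with (1 := Rabs_triang _ _).
          rewrite Rabs_R1, Rabs_Ropp. lra.
        * assert (H1 := pow2_ge_0 (f s + Derive f s)).
          assert (H2 := pow2_ge_0 (f s - Derive f s)).
          apply Rabs_le. split; lra.
    - rewrite Hf0, Hf'0. ring. }
  nra.
Qed.

(** * Roots of the quadratic, and the conclusion *)

(** Completing the square: (2 c x + A)^2 - D = 4 c (c x^2 + A x - K) < 0. As 2 c < 0, the root with
    [+ sqrt D] is the smaller one. *)
Lemma quadratic_sign (c A K x : R) :
  c < 0 -> K < c * x ^ 2 + A * x ->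
  let D := A ^ 2 + 4 * c * K in
  0 < D /\ (- A + sqrt D) / (2 * c) < x < (- A - sqrt D) / (2 * c).
Proof.
  intros Hc HK D.
  assert (HD : (2 * c * x + A) ^ 2 < D) by (unfold D; nra).
  assert (HD0 : 0 < D) by (assert (H := pow2_ge_0 (2 * c * x + A)); lra).
  assert (Hs : Rabs (2 * c * x + A) < sqrt D).
  { rewrite <- (sqrt_pow2 (Rabs _)) by apply Rabs_pos.
    rewrite pow2_abs. apply sqrt_lt_1_alt. split; [apply pow2_ge_0|exact HD]. }
  apply Rabs_lt_between in Hs.
  split; [exact HD0|].
  set (S := sqrt D) in *.
  assert (E1 : (- A + S) / (2 * c) - x = (S - (2 * c * x + A)) * / (2 * c))
    by (field; lra).
  assert (E2 : (- A - S) / (2 * c) - x = (- S - (2 * c * x + A)) * / (2 * c))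
    by (field; lra).
  assert (/ (2 * c) < 0) by (apply Rinv_lt_0_compat; lra).
  split; nra.
Qed.

(** Finitely many positive chords have a positive minimum; it separates the ring bodies once r is
    bounded below. *)
Lemma unity_root_sub1_bound (n : nat) :
  exists d, 0 < d /\ forall k, (0 < k < n)%nat -> d <= Cmod (unity_root n k - 1).
Proof.
  assert (H : forall m, (m <= n)%nat -> exists d, 0 < d /\
            forall k, (0 < k < m)%nat -> d <= Cmod (unity_root n k - 1)).
  { induction m as [|m IH]; intros Hm.
    - exists 1. split; [lra|]. intros k Hk; lia.
    - destruct IH as (d & Hd & Hk); [lia|].
      (* Index 0 must stay out of the minimum: its chord has length 0. *)
      destruct (Nat.eq_dec m 0) as [->|Hm0].
      + exists 1. split; [lra|]. intros k ?; lia.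
      + exists (Rmin d (Cmod (unity_root n m - 1))). split.
        * apply Rmin_glb_lt; [exact Hd|]. apply unity_root_sub1_pos; lia.
        * intros k Hkm. destruct (Nat.eq_dec k m) as [->|Hne].
          -- apply Rmin_r.
          -- apply Rle_trans with d; [apply Rmin_l|]. apply Hk; lia. }
  apply H; lia.
Qed.

Theorem theorem4p3 :
  forall (n : nat) (m1 m2 : R) (f r theta : R -> R) (ta tb : Rbar),
    (1 < n)%nat -> 0 < m1 -> 0 < m2 ->
    is_solution n m1 m2 f r theta ta tb ->
    let c1 := angular_momentum n m1 m2 f r theta in
    let c2 := energy n m1 m2 f r theta 0 in
    let D := 2 * INR n * c1 ^ 2 * c2 * m2
             + INR n ^ 2 * (m1 * m2 + b_ n / 2 * m2 ^ 2) ^ 2 in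
    c1 <> 0 -> c2 < 0 ->
    ~ has_collision n m1 m2 f r theta ta tb /\
    (nonplanar f ta tb ->
     0 < D /\
     forall t, in_interval ta tb t ->
       (- INR n * m1 * m2 - INR n * b_ n / 2 * m2 ^ 2 + sqrt D) / (2 * c2)
         < r t
       < (- INR n * m1 * m2 - INR n * b_ n / 2 * m2 ^ 2 - sqrt D) / (2 * c2)).
Proof.
  intros n m1 m2 f r theta ta tb Hn Hm1 Hm2 Hsol c1 c2 D Hc1 Hc2.
  assert (HN : 0 < INR n) by (apply lt_0_INR; lia).
  (* The quadratic is c2 x^2 + A x - K, and its discriminant A^2 + 4 c2 K equals [D]. *)
  set (A := INR n * m1 * m2 + INR n * b_ n / 2 * m2 ^ 2).
  set (K := INR n * m2 * c1 ^ 2 / 2).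
  assert (HK : 0 < K).
  { assert (0 < c1 ^ 2) by now apply pow2_gt_0.
    assert (0 < INR n * m2) by nra. unfold K; nra. }
  assert (HA : 0 < A).
  { assert (Hb := b_nonneg n Hn).
    assert (0 < INR n * m1 * m2) by (repeat apply Rmult_lt_0_compat; lra).
    assert (0 <= INR n * b_ n / 2 * m2 ^ 2)
      by (apply Rmult_le_pos; [nra|apply pow2_ge_0]).
    unfold A; lra. }
  assert (Hquad : forall t, in_interval ta tb t ->
    K <= c2 * r t ^ 2 + A * r t
    /\ (f t <> 0 \/ Derive f t <> 0 -> K < c2 * r t ^ 2 + A * r t)).
  { intros t Ht. unfold c2.
    rewrite <- (energy_const n m1 m2 f r theta ta tb t Hn Hm2 Hsol Ht).
    apply reduced_energy_ge; auto; [lia|].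
    now apply (sol_r_pos _ _ _ _ _ _ _ _ Hsol). }
  assert (Hr := sol_r_pos _ _ _ _ _ _ _ _ Hsol).
  assert (HKA : 0 < K / A) by now apply Rdiv_lt_0_compat.
  assert (Hlow : forall t, in_interval ta tb t -> K / A <= r t).
  { intros t Ht. destruct (Hquad t Ht) as [H _]. assert (H0 := pow2_ge_0 (r t)).
    apply (Rmult_le_reg_r A); [exact HA|].
    unfold Rdiv. rewrite Rmult_assoc, Rinv_l by lra. nra. }
  split.
  - intros (i & k & T & Hik & _ & _ & Hcol).
    destruct (unity_root_sub1_bound n) as (d & Hd & Hdk).
    assert (0 < K / A * d) by now apply Rmult_lt_0_compat.
    (* [K / A] bounds the axis-ring distances from below because h >= r, and [K / A * d] bounds the
       ring chords. Both hold on the whole interval, whatever T is. *)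
    destruct (Hcol (Rmin (K / A) (K / A * d))) as (t & Ht & _ & Hdist).
    { now apply Rmin_glb_lt. }
    specialize (Hr t Ht). specialize (Hlow t Ht).
    destruct i as [|i].
    + rewrite dist3_axis_ring in Hdist by (lia || lra).
      assert (H1 := h_ge_r n m1 m2 f r t Hr).
      assert (H2 := Rmin_l (K / A) (K / A * d)). lra.
    + rewrite dist3_ring_ring in Hdist by (lia || lra).
      assert (H1 := Hdk (k - S i)%nat ltac:(lia)).
      assert (H2 := Rmin_r (K / A) (K / A * d)).
      assert (K / A * d <= r t * Cmod (unity_root n (k - S i) - 1))
        by (apply Rmult_le_compat; lra).
      lra.
  - intros (t1 & Ht1 & Hft1).
    assert (HM : 0 < m1 + INR n * m2) by nra.
    (* If f and f' both vanished at t, uniqueness would carry f = 0 from t to [t1], against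
       [Hft1]. *)
    assert (Hnz : forall t, in_interval ta tb t -> f t <> 0 \/ Derive f t <> 0).
    { intros t Ht.
      destruct (Req_dec (f t) 0) as [H0|H0]; [|now left].
      destruct (Req_dec (Derive f t) 0) as [H1|H1]; [|now right].
      exfalso. apply Hft1.
      apply (linear_oscillator_unique f
               (fun s => (m1 + INR n * m2) / h_ n m1 m2 f r s ^ 3)
               ((m1 + INR n * m2) / (K / A) ^ 3) (in_interval ta tb) t t1); auto.
      - exact (in_interval_between ta tb).
      - intros s Hs. destruct (sol_f _ _ _ _ _ _ _ _ Hsol s Hs) as [D1 D2].
        assert (Hh := h_pos n m1 m2 f r s (Hr s Hs)).
        assert (Hh3 := pow_lt _ 3 Hh).
        split; [exact D1|split].
        + replace (- ((m1 + INR n * m2) / h_ n m1 m2 f r s ^ 3) * f s)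
            with (- ((m1 + INR n * m2) * f s) / h_ n m1 m2 f r s ^ 3)
            by (field; lra).
          exact D2.
        (* The coefficient is bounded through h >= r >= K / A. *)
        + rewrite Rabs_pos_eq by (left; now apply Rdiv_lt_0_compat).
          apply Rmult_le_compat_l; [lra|].
          apply Rinv_le_contravar; [now apply pow_lt|].
          apply pow_incr. split; [lra|].
          apply Rle_trans with (r s); [now apply Hlow|now apply h_ge_r, Hr]. }
    assert (HD : D = A ^ 2 + 4 * c2 * K) by (unfold D, A, K; field).
    replace (- INR n * m1 * m2 - INR n * b_ n / 2 * m2 ^ 2) with (- A)
      by (unfold A; ring).
    rewrite HD.
    assert (Hbounds := fun t (Ht : in_interval ta tb t) =>
      quadratic_sign c2 A K (r t) Hc2 (proj2 (Hquad t Ht) (Hnz t Ht))).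
    split.
    + apply (Hbounds t1 Ht1).
    + intros t Ht. apply (Hbounds t Ht).
Qed.
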